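(* Let $(N,Q_0,d,N^+)$ be non-commutative toric data. The associated non-commutative toric algebra $B=\mathbb{C}[\underline{M}^+]$ is a toric $R$-order, where $R:=\mathbb{C}[M_o^+]$.
   Context: **Setting.** Let $Q_0$ be a finite set and $N$ a lattice, with a lattice map $d:\mathbb{Z}^{Q_0}\to N$ whose kernel is $\mathbb{Z}\underline{1}$ (constant functions), and a subset $N^+\subset N$ which is the intersection with $N$ of a strongly convex rational polyhedral cone in $N\otimes_{\mathbb{Z}}\mathbb{R}$. Let $M=\operatorname{Hom}(N,\mathbb{Z})$, let $\partial:M\to\mathbb{Z}_{Q_0}$ (free abelian group on $Q_0$) be the dual map of $d$, and $M^+=\{u\in M:\langle u,v\rangle\ge0\ \forall v\in N^+\}$. For $i,j\in Q_0$ put $M_{ij}=\partial^{-1}(j-i)$ and $M_{ij}^+=M_{ij}\cap M^+$. Put $M_o=\partial^{-1}(0)$ and $M_o^+=M_o\cap M^+$. Let $M^{gen}$ be the submonoid of $M^+$ generated by the elements of $M_{ij}^+$ for all $i,j\in Q_0$. **Non-commutative toric data.** $(N,Q_0,d,N^+)$ is called non-commutative toric data if (1) $M_{ij}^+$ is non-empty for all $i,j\in Q_0$, and (2) $N^+=(M^{gen})^\vee:=\{v\in N:\langle u,v\rangle\ge0\ \forall u\in M^{gen}\}$. **Non-commutative toric algebra.** $B=\mathbb{C}[\underline{M}^+]=\bigoplus_{i,j\in Q_0}\mathbb{C}[M_{ij}^+]$, where $\mathbb{C}[M_{ij}^+]$ is the vector space with basis $x^m$, $m\in M_{ij}^+$,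 regarded as a formal matrix algebra with product $\mathbb{C}[M_{ij}^+]\otimes\mathbb{C}[M_{jk}^+]\to\mathbb{C}[M_{ik}^+]$, $x^{m_1}\otimes x^{m_2}\mapsto x^{m_1+m_2}$. It is an $R$-algebra via the diagonal embedding of $R=\mathbb{C}[M_o^+]=\mathbb{C}[M_{ii}^+]$. **Toric order.** Let $R\subset T$ be the coordinate ring of an affine toric variety, where $T=\mathbb{C}[M_o]$ is the coordinate ring of the dense open orbit of the torus action and $M_o$ is the character lattice. A toric $R$-order is an $M_o$-graded $R$-algebra $B$ with a (graded) embedding $B\hookrightarrow\operatorname{Mat}_n(T)$ (for some $n$) as a finitely generated $R$-submodule, such that the induced map $B\otimes_RT\to\operatorname{Mat}_n(T)$ is an isomorphism. *)

(* Defs.v *)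
From HB Require Import structures.
From mathcomp Require Import all_boot all_order all_algebra.
From mathcomp Require Import ring_quotient.
From mathcomp Require Import finmap boolp classical_sets reals.
From mathcomp Require Import complex monalg.

Set Implicit Arguments.
Unset Strict Implicit.
Unset Printing Implicit Defensive.

Import Order.TTheory GRing.Theory Num.Theory VectorInternalTheory.

Local Open Scope fset_scope.
Local Open Scope classical_set_scope.
Local Open Scope ring_scope.

(* Lattices (finitely generated free abelian groups) are the objects of type  *)
(* [vectType int]; the dual of N is ['Hom(N, int^o)].                         *)

(* The group algebra k[L]: finitely supported functions L -> k (the type      *)
(* {malg k[L]}) with the convolution product; << c *g m >> is the element     *)
(* c x^m.  The product of monalg is not available for it, as it requires a    *)
(* monoid without nontrivial units.                                           *)

Section GroupAlgebra.
Variables (k : comNzRingType) (L : zmodType).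

Definition grpalg : Type := {malg k[L]}.
HB.instance Definition _ := GRing.Lmodule.on grpalg.

Implicit Types (f g h : grpalg) (m : L).

Definition ga_one : grpalg := << 1 *g 0 >>.
Definition ga_mul f g : grpalg :=
  \sum_(m1 <- msupp f) \sum_(m2 <- msupp g) << f@_m1 * g@_m2 *g m1 + m2 >>.

Lemma ga_mulw (d1 d2 : {fset L}) f g :
  (msupp f `<=` d1)%fset -> (msupp g `<=` d2)%fset ->
  ga_mul f g = \sum_(m1 <- d1) \sum_(m2 <- d2) << f@_m1 * g@_m2 *g m1 + m2 >>.
Proof.
move=> le_d1 le_d2; rewrite /ga_mul (big_fset_incl _ le_d1) /=.
  apply/eq_bigr=> m1 _; apply/big_fset_incl => // m _ /mcoeff_outdom ->.
  by rewrite mulr0 monalgU0.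
move=> m _ /mcoeff_outdom fm.
by rewrite big1 => // m' _; rewrite fm mul0r monalgU0.
Qed.

Lemma ga_mulC : commutative ga_mul.
Proof.
move=> f g; rewrite /ga_mul exchange_big.
by apply: eq_bigr => m _; apply: eq_bigr => m' _; rewrite mulrC addrC.
Qed.

Lemma ga_mul0 : left_zero 0 ga_mul.
Proof. by move=> g; rewrite /ga_mul msupp0 big_seq_fset0. Qed.

Lemma ga_mulr0 : right_zero 0 ga_mul.
Proof. by move=> g; rewrite ga_mulC ga_mul0. Qed.

Lemma ga_mulUU c1 c2 m1 m2 :
  ga_mul << c1 *g m1 >> << c2 *g m2 >> = << c1 * c2 *g m1 + m2 >>.
Proof. by rewrite (ga_mulw msuppU_le msuppU_le) !big_seq_fset1 !mcoeffUU. Qed.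

Lemma ga_mulDl : left_distributive ga_mul +%R.
Proof.
move=> f1 f2 g.
rewrite (ga_mulw (fsubsetUl (msupp f1) (msupp f2)) (fsubset_refl (msupp g))).
rewrite (ga_mulw (fsubsetUr (msupp f1) (msupp f2)) (fsubset_refl (msupp g))).
rewrite (ga_mulw (msuppD_le f1 f2) (fsubset_refl (msupp g))).
rewrite -big_split /=; apply/eq_bigr=> m1 _.
rewrite -big_split /=; apply/eq_bigr=> m2 _.
by rewrite mcoeffD mulrDl monalgUD.
Qed.

Lemma ga_mulDr : right_distributive ga_mul +%R.
Proof. by move=> f g h; rewrite !(ga_mulC f) ga_mulDl. Qed.

Lemma ga_ind (P : grpalg -> Prop) :
  P 0 -> (forall f g, P f -> P g -> P (f + g)) ->
  (forall c m, P << c *g m >>) -> forall f, P f.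
Proof. by move=> P0 PD PU f; rewrite [f]monalgE; elim/big_ind: _. Qed.

Lemma ga_mulA : associative ga_mul.
Proof.
move=> f g h; elim/ga_ind: f => [|f1 f2 IH1 IH2|c1 m1].
- by rewrite !ga_mul0.
- by rewrite !ga_mulDl IH1 IH2.
elim/ga_ind: g => [|g1 g2 IH1 IH2|c2 m2].
- by rewrite !(ga_mul0, ga_mulr0).
- by rewrite ga_mulDl !ga_mulDr ga_mulDl IH1 IH2.
elim/ga_ind: h => [|h1 h2 IH1 IH2|c3 m3].
- by rewrite !(ga_mul0, ga_mulr0).
- by rewrite !ga_mulDr IH1 IH2.
by rewrite !ga_mulUU mulrA addrA.
Qed.

Lemma ga_mul1 : left_id ga_one ga_mul.
Proof.
move=> f; elim/ga_ind: f => [|f1 f2 IH1 IH2|c m].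
- by rewrite ga_mulr0.
- by rewrite ga_mulDr IH1 IH2.
by rewrite ga_mulUU mul1r add0r.
Qed.

Lemma ga_one_neq0 : ga_one != 0.
Proof. by apply/eqP/malgP=> /(_ 0) /eqP; rewrite !mcoeffsE oner_eq0. Qed.

HB.instance Definition _ := GRing.Zmodule_isComNzRing.Build grpalg
  ga_mulA ga_mulC ga_mul1 ga_mulDl ga_one_neq0.

Lemma ga_mulE f g : f * g = ga_mul f g. Proof. by []. Qed.
Lemma ga_1E : 1 = << 1 *g 0 >> :> grpalg. Proof. by []. Qed.

Definition supported (P : set L) f : Prop := forall m, f@_m != 0 -> P m.

Lemma supported0 P : supported P 0.
Proof. by move=> m; rewrite mcoeff0 eqxx. Qed.

Lemma supportedN P f : supported P f -> supported P (- f).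
Proof. by move=> Pf m; rewrite mcoeffN oppr_eq0 => /Pf. Qed.

Lemma supportedD P f g : supported P f -> supported P g -> supported P (f + g).
Proof.
move=> Pf Pg m; rewrite mcoeffD; have [->|/Pf//] := eqVneq (f@_m) 0.
by rewrite add0r => /Pg.
Qed.

Lemma supported_sum P (I : Type) (r : seq I) (F : I -> grpalg) :
  (forall i, supported P (F i)) -> supported P (\sum_(i <- r) F i).
Proof.
move=> PF; elim/big_ind: _ => // [|f g]; first exact: supported0.
exact: supportedD.
Qed.

Lemma supportedU (P : set L) c m : P m -> supported P << c *g m >>.
Proof.
by move=> Pm m'; rewrite mcoeffU; have [<-|_] := eqVneq m m' => //; rewrite mulr0n eqxx.
Qed.

Lemma supportedM (P Q S : set L) f g :
  (forall m1 m2, P m1 -> Q m2 -> S (m1 + m2)) ->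
  supported P f -> supported Q g -> supported S (f * g).
Proof.
move=> PQ Pf Qg; rewrite ga_mulE /ga_mul big_seq.
elim/big_ind: _ => [|? ?|m1 m1f]; [exact: supported0|exact: supportedD|].
rewrite big_seq.
elim/big_ind: _ => [|? ?|m2 m2f]; [exact: supported0|exact: supportedD|].
by apply: supportedU; apply: PQ; [apply: Pf|apply: Qg]; rewrite mcoeff_neq0.
Qed.

End GroupAlgebra.

Section GroupAlgebraMap.
Variables (k : comNzRingType) (L L' : zmodType) (h : {additive L -> L'}).

Definition ga_map (f : grpalg k L) : grpalg k L' :=
  \sum_(m <- msupp f) << f@_m *g h m >>.

Lemma ga_mapw (d : {fset L}) f : (msupp f `<=` d)%fset ->
  ga_map f = \sum_(m <- d) << f@_m *g h m >>.
Proof.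
move=> le_d; apply: big_fset_incl => // m _ /mcoeff_outdom ->.
by rewrite monalgU0.
Qed.

Lemma ga_mapU c m : ga_map << c *g m >> = << c *g h m >>.
Proof. by rewrite (ga_mapw msuppU_le) big_seq_fset1 mcoeffUU. Qed.

Lemma ga_mapD : {morph ga_map : f g / f + g}.
Proof.
move=> f g; rewrite (ga_mapw (fsubsetUl (msupp f) (msupp g))).
rewrite (ga_mapw (fsubsetUr (msupp f) (msupp g))) (ga_mapw (msuppD_le f g)).
by rewrite -big_split; apply: eq_bigr => m _; rewrite mcoeffD monalgUD.
Qed.

Lemma ga_map0 : ga_map 0 = 0.
Proof. by rewrite /ga_map msupp0 big_seq_fset0. Qed.

Lemma ga_map_nmod : nmod_morphism ga_map.
Proof. by split; [exact: ga_map0|exact: ga_mapD]. Qed.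
HB.instance Definition _ :=
  GRing.isNmodMorphism.Build (grpalg k L) (grpalg k L') ga_map ga_map_nmod.

Lemma ga_map_monoid : monoid_morphism ga_map.
Proof.
split=> [|f g]; first by rewrite !ga_1E ga_mapU raddf0.
elim/ga_ind: f => [|f1 f2 IH1 IH2|c1 m1].
- by rewrite mul0r raddf0 mul0r.
- by rewrite mulrDl !raddfD /= mulrDl IH1 IH2.
elim/ga_ind: g => [|g1 g2 IH1 IH2|c2 m2].
- by rewrite mulr0 raddf0 mulr0.
- by rewrite mulrDr !raddfD /= mulrDr IH1 IH2.
by rewrite !ga_mulE !(ga_mulUU, ga_mapU) raddfD.
Qed.
HB.instance Definition _ :=
  GRing.isMonoidMorphism.Build (grpalg k L) (grpalg k L') ga_map ga_map_monoid.

End GroupAlgebraMap.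

Record submonoid (L : zmodType) := Submonoid {
  submonoid_set :> set L;
  submonoid0 : submonoid_set 0;
  submonoidD : forall m1 m2,
    submonoid_set m1 -> submonoid_set m2 -> submonoid_set (m1 + m2)
}.

Section MonoidAlgebra.
Variables (k : comNzRingType) (L : zmodType) (S : submonoid L).

Definition monoid_pred : {pred grpalg k L} := fun f => `[< supported S f >].

Lemma monoid_pred_subring : subring_closed monoid_pred.
Proof.
split=> [|f g|f g]; rewrite !unfold_in.
- by apply/asboolP; rewrite ga_1E; apply: supportedU; exact: submonoid0.
- move=> /asboolP Sf /asboolP Sg; apply/asboolP.
  by apply: supportedD => //; exact: supportedN.
- move=> /asboolP Sf /asboolP Sg; apply/asboolP.
  by apply: supportedM Sf Sg; exact: submonoidD.
Qed.
HB.instance Definition _ :=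
  GRing.isSubringClosed.Build (grpalg k L) monoid_pred monoid_pred_subring.

Record monoid_alg := MonoidAlg {
  monoid_alg_val :> grpalg k L;
  _ : monoid_alg_val \in monoid_pred
}.
HB.instance Definition _ := [isSub for monoid_alg_val].
HB.instance Definition _ := [Choice of monoid_alg by <:].
HB.instance Definition _ := [SubChoice_isSubComNzRing of monoid_alg by <:].

End MonoidAlgebra.

Section KernelLattice.
Variables (M : vectType int) (I : finType) (f : {additive M -> {ffun I -> int}}).

Definition ker_pred : {pred M} := fun u => f u == 0.

Lemma ker_pred_submod : submod_closed ker_pred.
Proof.
split=> [|a u v]; rewrite !unfold_in ?raddf0 //.
move=> /eqP fu /eqP fv; rewrite raddfD /= fv addr0.
by rewrite -[a]intz scaler_int raddfMz fu mul0rz.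
Qed.
HB.instance Definition _ :=
  GRing.isSubmodClosed.Build int M ker_pred ker_pred_submod.

Record ker_lattice := KerLattice { ker_val :> M; _ : ker_val \in ker_pred }.
HB.instance Definition _ := [isSub for ker_val].
HB.instance Definition _ := [Choice of ker_lattice by <:].
HB.instance Definition _ := [SubChoice_isSubZmodule of ker_lattice by <:].
HB.instance Definition _ := [SubZmodule_isSubLmodule of ker_lattice by <:].

Fact ker_vect_axiom : {n : nat & Vector.axiom n ker_lattice}.
Proof.
pose A : 'M[int]_(dim M, #|I|) :=
  \matrix_(i, j) f (r2v (delta_mx 0 i)) (enum_val j).
have fE u j : f u (enum_val j) = (v2r u *m A) 0 j.
  rewrite -{1}[u]v2rK {1}[v2r u]row_sum_delta linear_sum raddf_sum sum_ffunE mxE.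
  apply: eq_bigr => i _; rewrite !mxE linearZ /= -{1}[v2r u 0 i]intz scaler_int.
  by rewrite raddfMz ffunMzE mulrzz mulrC.
have [Lm Lu [Rm Ru [d _ AE]]] := int_Smith_normal_form A.
pose D : 'M[int]_(dim M, #|I|) := \matrix_(i, j) (d`_i *+ (i == j :> nat)).
pose P (i : 'I_(dim M)) := ~~ ((i < #|I|)%N && (d`_i != 0)).
have kerE u : (u \in ker_pred) <-> forall i, ~~ P i -> (v2r u *m Lm) 0 i = 0.
  have -> : (u \in ker_pred) <-> v2r u *m A = 0.
    rewrite unfold_in; split => [/eqP fu|uA].
      by apply/rowP=> j; rewrite -fE fu ffunE mxE.
    by apply/eqP/ffunP=> i; rewrite -[ i]enum_rankK fE uA ffunE mxE.
  have -> : v2r u *m A = 0 <-> (v2r u *m Lm) *m D = 0.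
    rewrite AE !mulmxA; split => [/(congr1 (mulmx^~ (invmx Rm)))|->].
      by rewrite mulmxK // mul0mx.
    by rewrite mul0mx.
  set w := v2r u *m Lm; split => [wD i|w0].
    rewrite negbK => /andP[lti di]; move/rowP: wD => /(_ (Ordinal lti)).
    rewrite !mxE (bigD1 i) //= big1 ?mxE ?eqxx ?mulr1n ?addr0.
      by move/eqP; rewrite mulf_eq0 (negPf di) orbF => /eqP.
    move=> i' i'i; rewrite [D _ _]mxE /=.
    by have /negPf-> : (i' != i :> nat) by []; rewrite mulr0n mulr0.
  apply/rowP=> j; rewrite !mxE big1 // => i _; rewrite [D _ _]mxE.
  have [ij|_] := eqVneq (i : nat) j; last by rewrite mulr0n mulr0.
  have [->|di] := eqVneq d`_i 0; first by rewrite mul0rn mulr0.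
  by rewrite w0 ?mul0r // negbK di ij ltn_ord.
pose to (u : ker_lattice) : 'rV[int]_#|P| :=
  \row_j (v2r (val u) *m Lm) 0 (enum_val j).
pose ext (x : 'rV[int]_#|P|) : 'rV[int]_(dim M) :=
  \row_i \sum_j x 0 j *+ (i == enum_val j).
pose fro (x : 'rV[int]_#|P|) : M := r2v (ext x *m invmx Lm).
have froK x : v2r (fro x) *m Lm = ext x by rewrite r2vK mulmxKV.
have fro_ker x : fro x \in ker_pred.
  apply/kerE => i Pi; rewrite froK mxE big1 // => j _.
  have [iE|_] := eqVneq i (enum_val j); last by rewrite mulr0n.
  by case/negP: Pi; rewrite iE; exact: (enum_valP j).
have extE x j : ext x 0 (enum_val j) = x 0 j.
  rewrite mxE (bigD1 j) //= eqxx mulr1n big1 ?addr0 // => j' j'j.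
  by rewrite (inj_eq enum_val_inj) eq_sym (negPf j'j).
exists #|P|, to.
  move=> a u v; apply/rowP=> j; rewrite [LHS]mxE /= linearP mulmxDl -scalemxAl.
  by rewrite !mxE.
exists (fun x => KerLattice (fro_ker x)) => [u|x].
  apply/val_inj/v2r_inj => /=.
  apply: (can_inj (mulmxK Lu)); rewrite froK; apply/rowP=> i.
  have [Pi|nPi] := boolP (P i).
    by rewrite -[ i](enum_rankK_in Pi Pi) extE mxE.
  have /kerE/(_ _ nPi) -> := valP u.
  rewrite mxE big1 // => j _; have [iE|_] := eqVneq i (enum_val j); last by rewrite mulr0n.
  by case/negP: nPi; rewrite iE; exact: (enum_valP j).
by apply/rowP=> j; rewrite mxE /= froK extE.
Qed.
HB.instance Definition _ :=
  Lmodule_hasFinDim.Build int ker_lattice (projT2 ker_vect_axiom).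

End KernelLattice.

(* Rational polyhedral cones in N_R = N (x) R.  N_R is identified with        *)
(* R^(rank N) by the isomorphism v2r : N -> Z^(rank N) attached to N.         *)

Section Cones.
Variables (R : realType) (N : vectType int).

Definition to_real (v : N) : 'rV[R]_(dim N) := map_mx intr (v2r v).

Definition cone_generated_by (s : seq N) : set 'rV[R]_(dim N) :=
  [set x | exists c : 'I_(size s) -> R,
     (forall i, 0 <= c i) /\ x = \sum_i c i *: to_real (s`_i)].

Definition rational_polyhedral_cone (sigma : set 'rV[R]_(dim N)) : Prop :=
  exists s : seq N, sigma = cone_generated_by s.

Definition strongly_convex (sigma : set 'rV[R]_(dim N)) : Prop :=
  forall x, sigma x -> sigma (- x) -> x = 0.

Definition lattice_points (sigma : set 'rV[R]_(dim N)) : set N :=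
  [set v | sigma (to_real v)].

Definition scrp_cone_points (A : set N) : Prop :=
  exists sigma, [/\ rational_polyhedral_cone sigma, strongly_convex sigma
                  & A = lattice_points sigma].

End Cones.

Section ToricData.
Variables (Q0 : finType) (N : vectType int).
Variables (d : {additive {ffun Q0 -> int} -> N}) (Np : set N).

Local Notation M := 'Hom(N, int^o).

Definition chi (i : Q0) : {ffun Q0 -> int} := [ffun j => (j == i)%:R].

(* The transpose of d, with Z_{Q0} identified with {ffun Q0 -> int} through   *)
(* its basis Q0.                                                              *)
Definition bdry (u : M) : {ffun Q0 -> int} := [ffun i => u (d (chi i))].

Lemma bdry_nmod : nmod_morphism bdry.
Proof.
by split=> [|u v]; apply/ffunP=> i; rewrite !ffunE ?zero_lfunE ?add_lfunE.
Qed.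
HB.instance Definition _ :=
  GRing.isNmodMorphism.Build M {ffun Q0 -> int} bdry bdry_nmod.

Definition Mplus : set M := [set u | forall v, Np v -> 0 <= (u v : int)].
Definition Mij (i j : Q0) : set M := [set u | bdry u = chi j - chi i].
Definition Mijplus (i j : Q0) : set M := Mij i j `&` Mplus.

Inductive Mgen : M -> Prop :=
  | Mgen0 : Mgen 0
  | MgenD i j u v : Mijplus i j u -> Mgen v -> Mgen (u + v).

Definition Mgen_dual : set N :=
  [set v | forall u, Mgen u -> 0 <= (u v : int)].

Record nc_toric_data (R : realType) : Prop := {
  nctd_ker : forall f, d f = 0 <-> exists c : int, f = [ffun=> c];
  nctd_cone : scrp_cone_points R Np;
  nctd_nonempty : forall i j, Mijplus i j !=set0;
  nctd_dual : Np = Mgen_dual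
}.

Lemma Mplus0 : Mplus 0.
Proof. by move=> v _; rewrite zero_lfunE. Qed.

Lemma MplusD u v : Mplus u -> Mplus v -> Mplus (u + v).
Proof.
by move=> Pu Pv w Nw; rewrite add_lfunE; apply: addr_ge0; [apply: Pu|apply: Pv].
Qed.

Lemma Mijplus0 i : Mijplus i i 0.
Proof. by split; [rewrite /Mij /= raddf0 subrr|exact: Mplus0]. Qed.

Lemma MijplusD i j k u v : Mijplus i j u -> Mijplus j k v -> Mijplus i k (u + v).
Proof.
move=> [uE Pu] [vE Pv]; split; last exact: MplusD.
by rewrite /Mij /= raddfD /= uE vE addrC addrA subrK.
Qed.

Definition Mo : vectType int := ker_lattice bdry.

Lemma Moplus0 : Mplus (\val (0 : Mo)).
Proof. exact: Mplus0. Qed.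
Lemma MoplusD (u v : Mo) :
  Mplus (\val u) -> Mplus (\val v) -> Mplus (\val (u + v)).
Proof. exact: MplusD. Qed.
Definition Moplus : submonoid Mo :=
  @Submonoid Mo [set u | Mplus (\val u)] Moplus0 MoplusD.

End ToricData.

(* The formal matrix algebra: matrices indexed by Q0 whose (i, j) entry lies  *)
(* in the span k[M_ij^+] of the x^m, m in M_ij^+, inside k[M].                *)

Section NCToricAlgebra.
Variables (k : comNzRingType) (Q0 : finType) (N : vectType int).
Variables (d : {additive {ffun Q0 -> int} -> N}) (Np : set N).

Local Notation M := 'Hom(N, int^o).
Local Notation mats := 'M[grpalg k M]_#|Q0|.

Definition nc_toric_pred : {pred mats} := fun A =>
  `[< forall i j, supported (Mijplus d Np (enum_val i) (enum_val j)) (A i j) >].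

Lemma nc_toric_pred_subring : subring_closed nc_toric_pred.
Proof.
split=> [|A B|A B]; rewrite !unfold_in.
- apply/asboolP => i j; rewrite mxE; case: eqVneq => [->|_].
    by rewrite ga_1E; apply: supportedU; exact: Mijplus0.
  exact: supported0.
- move=> /asboolP hA /asboolP hB; apply/asboolP => i j; rewrite !mxE.
  by apply: supportedD => //; exact: supportedN.
- move=> /asboolP hA /asboolP hB; apply/asboolP => i j; rewrite mxE.
  apply: supported_sum => l; apply: supportedM (hA i l) (hB l j).
  by move=> u v; exact: MijplusD.
Qed.
HB.instance Definition _ :=
  GRing.isSubringClosed.Build mats nc_toric_pred nc_toric_pred_subring.

Record nc_toric_alg := NCToricAlg {
  nc_toric_val :> mats;
  _ : nc_toric_val \in nc_toric_pred
}.
HB.instance Definition _ := [isSub for nc_toric_val].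
HB.instance Definition _ := [Choice of nc_toric_alg by <:].
HB.instance Definition _ :=
  GRing.SubChoice_isSubPzRing.Build _ _ nc_toric_alg nc_toric_pred_subring.

Definition diag_mats (r : monoid_alg k (Moplus d Np)) : mats :=
  (ga_map (\val : {additive Mo d -> M}) (\val r))%:M.

Lemma diag_mats_in r : diag_mats r \in nc_toric_pred.
Proof.
rewrite unfold_in; apply/asboolP => i j; rewrite mxE.
case: eqVneq => [->|_]; last exact: supported0.
rewrite mulr1n /ga_map big_seq.
elim/big_ind: _ => [|? ?|m mr]; [exact: supported0|exact: supportedD|].
apply: supportedU; split.
  by rewrite /Mij /= subrr; apply/eqP; exact: (valP m).
have := valP r; rewrite unfold_in => /asboolP; apply.
by rewrite mcoeff_neq0.
Qed.

Definition diag_emb (r : monoid_alg k (Moplus d Np)) : nc_toric_alg :=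
  NCToricAlg (diag_mats_in r).

Lemma diag_emb_nmod : nmod_morphism diag_emb.
Proof.
split=> [|r s]; apply: val_inj; rewrite /= /diag_mats.
  by rewrite !raddf0.
by rewrite !raddfD.
Qed.
HB.instance Definition _ := GRing.isNmodMorphism.Build
  (monoid_alg k (Moplus d Np)) nc_toric_alg diag_emb diag_emb_nmod.

Lemma diag_emb_monoid : monoid_morphism diag_emb.
Proof.
split=> [|r s]; apply: val_inj; rewrite /= /diag_mats.
  by rewrite !rmorph1.
by rewrite !rmorphM.
Qed.
HB.instance Definition _ := GRing.isMonoidMorphism.Build
  (monoid_alg k (Moplus d Np)) nc_toric_alg diag_emb diag_emb_monoid.

End NCToricAlgebra.

(* The tensor product B (x)_A T of modules B, T over a commutative ring A,    *)
(* the scalar multiplications of which are given by actB and actT: the        *)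
(* quotient of the free abelian group on B * T by the usual relations.        *)

Section Tensor.
Variables (A : Type) (B T : zmodType) (actB : A -> B -> B) (actT : A -> T -> T).

Local Notation free := {malg int[(B * T)%type]}.
Local Notation gen b t := (<< 1 *g (b, t) >> : free).

Inductive tensor_rel : free -> Prop :=
  | tensor_rel0 : tensor_rel 0
  | tensor_relB x y : tensor_rel x -> tensor_rel y -> tensor_rel (x - y)
  | tensor_rel_addl b b' t :
      tensor_rel (gen (b + b') t - (gen b t + gen b' t))
  | tensor_rel_addr b t t' :
      tensor_rel (gen b (t + t') - (gen b t + gen b t'))
  | tensor_rel_act a b t : tensor_rel (gen (actB a b) t - gen b (actT a t)).

Definition tensor_pred : {pred free} := fun x => `[< tensor_rel x >].

Lemma tensor_pred_zmod : zmod_closed tensor_pred.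
Proof.
split=> [|x y]; rewrite !unfold_in; first exact/asboolP/tensor_rel0.
by move=> /asboolP hx /asboolP hy; apply/asboolP/tensor_relB.
Qed.
HB.instance Definition _ :=
  GRing.isZmodClosed.Build free tensor_pred tensor_pred_zmod.

Definition tensor : zmodType := Quotient.quot tensor_pred.

Definition tensor_pure (b : B) (t : T) : tensor := (\pi_tensor (gen b t))%qT.

(* The additive map b (x) t |-> F b t induced by a balanced biadditive map F, *)
(* see tensor_lift_additive and tensor_lift_pure.                             *)
Section Lift.
Variables (V : zmodType) (F : B -> T -> V).

Definition free_lift (x : free) : V :=
  \sum_(p <- msupp x) F p.1 p.2 *~ x@_p.

Definition tensor_lift (q : tensor) : V := free_lift (repr q).

Lemma free_liftw (D : {fset (B * T)%type}) x : (msupp x `<=` D)%fset ->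
  free_lift x = \sum_(p <- D) F p.1 p.2 *~ x@_p.
Proof.
by move=> le_D; apply: big_fset_incl => // p _ /mcoeff_outdom ->; rewrite mulr0z.
Qed.

Lemma free_liftB x y : free_lift (x - y) = free_lift x - free_lift y.
Proof.
rewrite (free_liftw (fsubsetUl (msupp x) (msupp y))).
rewrite (free_liftw (fsubsetUr (msupp x) (msupp y))).
rewrite (free_liftw (msuppB_le x y)) -sumrB.
by apply: eq_bigr => p _; rewrite mcoeffB mulrzBr.
Qed.

Lemma free_liftD x y : free_lift (x + y) = free_lift x + free_lift y.
Proof.
rewrite (free_liftw (fsubsetUl (msupp x) (msupp y))).
rewrite (free_liftw (fsubsetUr (msupp x) (msupp y))).
rewrite (free_liftw (msuppD_le x y)) -big_split.
by apply: eq_bigr => p _; rewrite mcoeffD mulrzDr.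
Qed.

Lemma free_lift_gen b t : free_lift (gen b t) = F b t.
Proof. by rewrite (free_liftw msuppU_le) big_seq_fset1 mcoeffUU. Qed.

Hypothesis FDl : forall b b' t, F (b + b') t = F b t + F b' t.
Hypothesis FDr : forall b t t', F b (t + t') = F b t + F b t'.
Hypothesis Fbal : forall a b t, F (actB a b) t = F b (actT a t).

Lemma free_lift_rel x : tensor_rel x -> free_lift x = 0.
Proof.
elim=> [|{}x y _ hx _ hy|b b' t|b t t'|a b t].
- by rewrite /free_lift msupp0 big_seq_fset0.
- by rewrite free_liftB hx hy subrr.
- by rewrite free_liftB free_liftD !free_lift_gen FDl subrr.
- by rewrite free_liftB free_liftD !free_lift_gen FDr subrr.
- by rewrite free_liftB !free_lift_gen Fbal subrr.
Qed.

Lemma tensor_lift_pi x : tensor_lift (\pi_tensor x)%qT = free_lift x.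
Proof.
apply/eqP; rewrite -subr_eq0 -free_liftB; apply/eqP/free_lift_rel.
have : repr (\pi_tensor x)%qT - x \in tensor_pred.
  by rewrite Quotient.idealrBE reprK.
by rewrite unfold_in => /asboolP.
Qed.

Lemma tensor_lift_pure b t : tensor_lift (tensor_pure b t) = F b t.
Proof. by rewrite tensor_lift_pi free_lift_gen. Qed.

Lemma tensor_lift_additive : {morph tensor_lift : p q / p + q}.
Proof.
move=> p q; rewrite -[p]reprK -[q]reprK.
have -> : (\pi_tensor (repr p) + \pi_tensor (repr q) =
           \pi_tensor (repr p + repr q))%qT by rewrite !piE.
by rewrite !tensor_lift_pi free_liftD.
Qed.

End Lift.
End Tensor.

Section ToricOrder.
Variables (R : realType) (L : vectType int) (S : submonoid L).

Local Notation C := (R[i])%type.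
Local Notation RS := (monoid_alg C S).
Local Notation T := (grpalg C L).

(* Spec C[S] is an affine toric variety with dense torus Spec C[L]: S is the  *)
(* set of characters that are nonnegative on the lattice points of a strongly *)
(* convex rational polyhedral cone in the cocharacter space L^v (x) R.        *)
Definition affine_toric : Prop :=
  exists2 A : set 'Hom(L, int^o), scrp_cone_points R A
    & S = [set m | forall v, A v -> 0 <= (v m : int)] :> set L.

Definition homogeneous (m : L) (t : T) : Prop := supported [set m] t.

Variables (B : pzRingType) (iota : {rmorphism RS -> B}).

Record is_grading (B_ : L -> set B) : Prop := {
  grading0 : forall m, B_ m 0;
  gradingD : forall m b b', B_ m b -> B_ m b' -> B_ m (b + b');
  grading_scale : forall m m' (r : RS) b,
    homogeneous m (\val r) -> B_ m' b -> B_ (m + m') (iota r * b);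
  grading_direct : forall b, exists! f : {malg B[L]},
    (forall m, B_ m f@_m) /\ b = \sum_(m <- msupp f) f@_m;
  grading1 : B_ 0 1;
  gradingM : forall m m' b b', B_ m b -> B_ m' b' -> B_ (m + m') (b * b')
}.

(* B is a C[S]-algebra through the central homomorphism iota; it is not an    *)
(* algType because the zero ring is allowed (Q0 may be empty).                *)
Definition toric_order : Prop :=
  [/\ affine_toric,
      forall r b, iota r * b = b * iota r
    & exists (B_ : L -> set B) (n : nat) (phi : {rmorphism B -> 'M[T]_n}),
      [/\ is_grading B_,
          injective phi /\ (forall r, phi (iota r) = (\val r)%:M),
          forall m b, B_ m b -> forall i j, homogeneous m (phi b i j),
          exists s : seq 'M[T]_n, forall X, (exists b, phi b = X) <->
            exists c : 'I_(size s) -> RS, X = \sum_i \val (c i) *: s`_i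
        & bijective (tensor_lift
            (fun (b : B) (t : T) => t *: phi b)
            : tensor (fun (r : RS) b => iota r * b)
                     (fun (r : RS) (t : T) => \val r * t) -> 'M[T]_n)]].

End ToricOrder.

(* Main.v *)
(** Fix [u_i] in [M] with [bdry u_i = chi i - c] for a vector [c] independent
    of [i] (such as [chi i0]).  Since the coordinates of [bdry m] sum to [0],
    [m |-> m - \sum_i (bdry m)_i u_i] is an additive retraction of [M] onto
    [M_o], and on [M_ij] it is the translation by [u_i - u_j].  Applying it
    to the exponents embeds [B] into [Mat_n(T)], the image being the matrices
    whose [(i, j)] entry is supported in
    [D_ij = {m in M_o | m + u_j - u_i in M^+}].

    Let [s] generate the cone of [N^+].  Comparing the values on [s], Dickson's
    lemma writes [D_ij] as a finite union of translates of [M_o^+], so [B] is a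
    finitely generated [R]-module.  An element of [N^+] killed by [M_o^+] is
    killed by [M^gen], as [M_ij^+ + M_ji^+] lies in [M_o^+]; by duality its
    opposite lies in [N^+], so it is [0] by strong convexity.  Hence some [m0]
    in [M_o^+] is positive on every nonzero element of [s].  This makes the
    cone spanned by the restrictions of [s] to [M_o] strongly convex, and
    every [m] in [M_o] satisfies [m + K m0 \in M_o^+] for large [K], so
    [T = R[x^-m0]].  Every tensor is then of the form [b (x) x^(-K m0)], on
    which the comparison map is visibly injective; it is surjective as each
    [M_ij^+] is non-empty. *)

Require Import Defs.
From HB Require Import structures.
From mathcomp Require Import all_boot all_order all_algebra.
From mathcomp Require Import ring_quotient finmap boolp classical_sets reals.
From mathcomp Require Import complex monalg.

Set Implicit Arguments.
Unset Strict Implicit.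
Unset Printing Implicit Defensive.

Import Order.TTheory GRing.Theory Num.Theory VectorInternalTheory.

Local Open Scope fset_scope.
Local Open Scope classical_set_scope.
Local Open Scope ring_scope.

(** Induction on [gs]. Let [F0] serve for the shorter list and let [K] be the maximum of [g] on
    [F0]. Where [g x] is at least [K], [F0] still works; each of the finitely many slices [g = l]
    with [l] below [K] is handled by the induction hypothesis. *)
Lemma dickson (X : eqType) (gs : seq (X -> nat)) (P : set X) :
  exists F : seq X, (forall f, f \in F -> P f) /\
    forall x, P x -> exists2 f, f \in F & all (fun g => g f <= g x)%N gs.
Proof.
elim: gs P => [|g gs IH] P.
  have [[x0 Px0]|noP] := pselect (P !=set0).
    exists [:: x0]; split=> [f|x _]; first by rewrite inE => /eqP->.
    by exists x0; rewrite ?inE.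
  by exists [::]; split=> // x Px; case: noP; exists x.
have [F0 [F0P F0d]] := IH P.
have [F FE] := choice (fun l => IH (P `&` [set x | g x = l])).
pose K := \max_(f <- F0) g f.
exists (F0 ++ flatten [seq F l | l <- iota 0 K]); split=> [f|x Px].
  rewrite mem_cat => /orP[/F0P//|/flatten_mapP[l _]].
  by case: (FE l) => FP _ /FP[].
have [Kx|xK] := leqP K (g x).
  have [f fF0 fx] := F0d x Px; exists f; first by rewrite mem_cat fF0.
  rewrite /= fx andbT; apply: leq_trans Kx.
  by rewrite /K (big_rem f) //= leq_maxl.
have [FP /(_ x)[//|f fF fx]] := FE (g x); exists f.
  rewrite mem_cat; apply/orP; right; apply/flatten_mapP; exists (g x) => //.
  by rewrite mem_iota.
by rewrite /= fx; have [_ ->] := FP f fF; rewrite leqnn.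
Qed.

(** * Supports and functoriality of group algebras *)

Section GroupAlgebraTheory.
Variables (k : comNzRingType) (L : zmodType).

Lemma supported_ind (A : set L) (P : grpalg k L -> Prop) :
  P 0 -> (forall f g, P f -> P g -> P (f + g)) ->
  (forall c m, A m -> P << c *g m >>) -> forall f, supported A f -> P f.
Proof.
move=> P0 PD PU f Af; rewrite [f]monalgE big_seq; elim/big_ind: _ => // m mf.
by apply/PU/Af; rewrite mcoeff_neq0.
Qed.

Lemma supported1E (m : L) (f : grpalg k L) :
  supported [set m] f -> f = << f@_m *g m >>.
Proof.
move=> fm; apply/malgP => m'; rewrite mcoeffU.
have [->|m'm] := eqVneq m m'; first by rewrite mulr1n.
rewrite mulr0n; apply/eqP/negPn/negP => /fm /= E.
by rewrite E eqxx in m'm.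
Qed.

Lemma ga_mapK (L' : zmodType) (h : {additive L -> L'})
    (g : {additive L' -> L}) :
  cancel h g -> cancel (ga_map (k := k) h) (ga_map g).
Proof.
move=> hK; elim/ga_ind => [|f1 f2 IH1 IH2|c m]; first by rewrite !raddf0.
  by rewrite !raddfD /= IH1 IH2.
by rewrite !ga_mapU hK.
Qed.

Lemma supported_map (L' : zmodType) (h : {additive L -> L'}) (A : set L)
    (A' : set L') (f : grpalg k L) :
  (forall m, A m -> A' (h m)) -> supported A f -> supported A' (ga_map h f).
Proof.
move=> AA' Af; elim/supported_ind: Af.
- by rewrite raddf0; exact: supported0.
- by move=> f1 f2; rewrite raddfD /=; exact: supportedD.
- by move=> c m /AA' Am; rewrite ga_mapU; exact: supportedU.
Qed.

End GroupAlgebraTheory.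

Section MonoidAlgebraTheory.
Variables (k : comNzRingType) (L : zmodType) (S : submonoid L).

Lemma monoid_algU_subproof (c : k) (m : L) :
  (S : set L) m -> (<< c *g m >> : grpalg k L) \in monoid_pred S.
Proof. by move=> Sm; rewrite unfold_in; apply/asboolP; exact: supportedU. Qed.

Definition monoid_algU c m (Sm : (S : set L) m) :=
  MonoidAlg (monoid_algU_subproof c Sm).

End MonoidAlgebraTheory.

(** * Spans over a monoid algebra *)

Section Span.
Variables (k : comNzRingType) (L : zmodType) (S : submonoid L).
Variable V : lmodType (grpalg k L).
Implicit Type s : seq V.

(** The shape is that of the finite generation clause of [toric_order], to which it is convertible
    when [V] is a space of matrices. *)
Definition span_over s (x : V) : Prop :=
  exists c : 'I_(size s) -> monoid_alg k S, x = \sum_i \val (c i) *: s`_i.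

Lemma span_over0 s : span_over s 0.
Proof. by exists (fun=> 0); rewrite big1 // => i _; rewrite raddf0 scale0r. Qed.

Lemma span_overD s x y : span_over s x -> span_over s y -> span_over s (x + y).
Proof.
move=> [c ->] [c' ->]; exists (fun i => c i + c' i); rewrite -big_split /=.
by apply: eq_bigr => i _; rewrite -scalerDl.
Qed.

Lemma span_over_gen s (r : monoid_alg k S) x :
  x \in s -> span_over s (\val r *: x).
Proof.
rewrite -index_mem => ltxs; pose i0 := Ordinal ltxs.
exists (fun i => if i == i0 then r else 0).
rewrite (bigD1 i0) //= eqxx nth_index -?index_mem // big1 ?addr0 // => i i_i0.
by rewrite ifN //; exact: scale0r.
Qed.

End Span.

(** * Calculus in the tensor product *)

Section TensorTheory.
Variables (A : Type) (B T : zmodType) (actB : A -> B -> B) (actT : A -> T -> T).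
Local Notation pure := (tensor_pure actB actT).

Let pi_eq (x y : {malg int[(B * T)%type]}) : tensor_rel actB actT (x - y) ->
  (\pi_(tensor actB actT) x = \pi_(tensor actB actT) y)%qT.
Proof.
by move=> xy; apply/eqP; rewrite -Quotient.idealrBE unfold_in; apply/asboolP.
Qed.

Lemma tensor_pureDl b b' t : pure (b + b') t = pure b t + pure b' t.
Proof. by rewrite /tensor_pure -raddfD; exact/pi_eq/tensor_rel_addl. Qed.

Lemma tensor_pureDr b t t' : pure b (t + t') = pure b t + pure b t'.
Proof. by rewrite /tensor_pure -raddfD; exact/pi_eq/tensor_rel_addr. Qed.

Lemma tensor_pure_act a b t : pure (actB a b) t = pure b (actT a t).
Proof. exact/pi_eq/tensor_rel_act. Qed.

Lemma tensor_pure0l t : pure 0 t = 0.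
Proof. by apply: (addrI (pure 0 t)); rewrite -tensor_pureDl !addr0. Qed.

Lemma tensor_pure0r b : pure b 0 = 0.
Proof. by apply: (addrI (pure b 0)); rewrite -tensor_pureDr !addr0. Qed.

Lemma tensor_pureNl b t : pure (- b) t = - pure b t.
Proof.
by apply: (addrI (pure b t)); rewrite -tensor_pureDl !subrr tensor_pure0l.
Qed.

(** Every tensor is an integer combination of pure ones, and closure under differences yields all
    integer multiples. *)
Lemma tensor_ind (P : tensor actB actT -> Prop) :
  (forall p q, P p -> P q -> P (p - q)) -> (forall b t, P (pure b t)) ->
  forall q, P q.
Proof.
move=> PB Pp q; have P0 : P 0 by rewrite -(subrr (pure 0 0)); exact: PB.
have PN x : P x -> P (- x) by rewrite -sub0r; exact: PB.
have PD x y : P x -> P y -> P (x + y).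
  by move=> Px Py; rewrite -[y]opprK; apply/PB/PN.
have PMn x n : P x -> P (x *+ n).
  by move=> Px; elim: n => [|n IHn]; rewrite ?mulr0n // mulrS; exact: PD.
have PMz x c : P x -> P (x *~ c).
  by case: c => n Px; [exact: PMn|rewrite NegzE mulrNz; apply/PN/PMn].
rewrite -[q]reprK [repr q]monalgE raddf_sum; elim/big_ind: _ => //= -[b t] _.
by rewrite -[mcoeff _ _]intz raddfMz raddfMz; exact/PMz/Pp.
Qed.

End TensorTheory.

(** * Grading and comparison map of an embedded algebra *)

Section OrderCriterion.
Variables (R : realType) (L : vectType int) (S : submonoid L).
Local Notation C := (R[i])%type.
Local Notation RS := (monoid_alg C S).
Local Notation T := (grpalg C L).
Variables (B : pzRingType) (iota : {rmorphism RS -> B}) (n : nat).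
Variable phi : {rmorphism B -> 'M[T]_n}.
Hypothesis phi_inj : injective phi.
Hypothesis phi_iota : forall r, phi (iota r) = (\val r)%:M.

Lemma phi_act r b : phi (iota r * b) = \val r *: phi b.
Proof. by rewrite rmorphM phi_iota; exact: mul_scalar_mx. Qed.

Definition pullback_grading (m : L) : set B :=
  [set b | forall i j, homogeneous m (phi b i j)].

(** The hypothesis says that the image of [phi] contains the homogeneous components of its elements.
    Injectivity of [phi] then transports the decomposition of matrices, and its uniqueness, to
    [B]. *)
Lemma pullback_is_grading :
  (forall b m, exists b', forall i j,
     phi b' i j = << (phi b i j)@_m *g m >>) ->
  is_grading iota pullback_grading.
Proof.
move=> components; split.
- by move=> m i j; rewrite raddf0 mxE; exact: supported0.
- move=> m b b' hb hb' i j; rewrite raddfD mxE.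
  exact: supportedD (hb i j) (hb' i j).
- move=> m m' r b hr hb i j; rewrite phi_act mxE; apply: supportedM hr (hb i j).
  by move=> ? ? -> ->.
- move=> b; have [comp compE] := choice (components b).
  (* [E] collects the exponents of all entries of [phi b]; outside it the components vanish, so they
     form a finitely supported function. *)
  pose E := seq_fset tt (flatten [seq enum_fset (msupp (phi b ij.1 ij.2)) |
                            ij <- enum [the finType of ('I_n * 'I_n)%type]]).
  have sub_E i j : (msupp (phi b i j) `<=` E)%fset.
    apply/fsubsetP=> m mb; rewrite seq_fsetE; apply/flatten_mapP.
    by exists (i, j); rewrite ?mem_enum.
  have comp0 m : m \notin E -> comp m = 0.
    move=> mE; apply: phi_inj; apply/matrixP=> i j; rewrite compE raddf0 mxE.
    rewrite mcoeff_outdom ?monalgU0 //.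
    by apply: contra mE; move/fsubsetP: (sub_E i j); apply.
  pose f : {malg B[L]} := [malg m in E => comp m].
  have fE m : f@_m = comp m.
    by rewrite mcoeffE; case: ifPn => // /comp0.
  exists f; split=> [|f' [hf' bE]].
    split=> [m i j|].
      by rewrite fE compE; exact: supportedU.
    have subf : (msupp f `<=` E)%fset.
      apply/fsubsetP=> m; apply: contraTT => mE.
      by rewrite -mcoeff_eq0 fE comp0.
    rewrite (big_fset_incl _ subf) => [|m _ /mcoeff_outdom //].
    apply: phi_inj; apply/matrixP=> i j; rewrite raddf_sum summxE.
    rewrite {1}(monalgEw (sub_E i j)).
    by apply: eq_bigr => m _; rewrite fE compE.
  (* Uniqueness: in the entries of [phi b], only the term of degree [m] contributes to the
     coefficient at [m]. *)
  apply/malgP=> m; rewrite fE; apply: phi_inj; apply/matrixP=> i j.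
  rewrite compE (supported1E (hf' m i j)); congr << _ *g _ >>.
  rewrite bE raddf_sum summxE raddf_sum /=.
  have [mf'|mf'] := boolP (m \in msupp f').
    rewrite (bigD1_seq m) //= big1 ?addr0 // => m' m'm.
    by rewrite (supported1E (hf' m' i j)) mcoeffU (negPf m'm).
  rewrite (mcoeff_outdom mf') raddf0 mxE mcoeff0 big_seq big1 // => m' m'f'.
  rewrite (supported1E (hf' m' i j)) mcoeffU; case: eqP => // E'.
  by rewrite -E' m'f' in mf'.
- move=> i j; rewrite rmorph1 mxE; case: eqP => _; last exact: supported0.
  by rewrite ga_1E; exact: supportedU.
- move=> m m' b b' hb hb' i j; rewrite rmorphM mxE; apply: supported_sum => l.
  by apply: supportedM (hb i l) (hb' l j) => ? ? -> ->.
Qed.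

Local Notation actB := (fun (r : RS) b => iota r * b).
Local Notation actT := (fun (r : RS) (t : T) => \val r * t).
Local Notation pure := (tensor_pure actB actT).
Local Notation lift := (tensor_lift (fun (b : B) (t : T) => t *: phi b)
  : tensor actB actT -> 'M[T]_n).

Let xm (m : L) : T := << 1 *g m >>.
Let xmD m m' : xm (m + m') = xm m * xm m'.
Proof. by rewrite ga_mulE ga_mulUU mulr1. Qed.

Let xmV m : xm m * xm (- m) = 1.
Proof. by rewrite -xmD subrr. Qed.

(** Injectivity comes from a common denominator: each tensor is [b] tensored with the unit
    [xm (- (m0 *+ K))]. Surjectivity holds because the image contains a unit multiple of each matrix
    unit. *)
Lemma tensor_lift_bij (m0 : L) :
  (S : set L) m0 -> (forall m, exists K, (S : set L) (m + m0 *+ K)) ->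
  (forall i j, exists m b, phi b = xm m *: delta_mx i j) ->
  bijective lift.
Proof.
move=> Sm0 Sden delta_in.
have SmK K : (S : set L) (m0 *+ K).
  elim: K => [|K IHK]; first by rewrite mulr0n; exact: submonoid0.
  by rewrite mulrS; exact: submonoidD.
have FDl b b' t : t *: phi (b + b') = t *: phi b + t *: phi b'.
  by rewrite raddfD scalerDr.
have FDr b t t' : (t + t') *: phi b = t *: phi b + t' *: phi b.
  by rewrite scalerDl.
have Fbal (r : RS) b t : t *: phi (iota r * b) = (\val r * t) *: phi b.
  by rewrite phi_act scalerA mulrC.
have liftp b t : lift (pure b t) = t *: phi b by exact: tensor_lift_pure.
have liftD : {morph lift : p q / p + q} by exact: tensor_lift_additive.
pose den q := exists K b, q = pure b (xm (- (m0 *+ K))).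
(* The denominator is enlarged by moving the factor [xm (m0 *+ K')], which lies in the monoid
   algebra, across the tensor sign. *)
have raise b K K' :
    pure b (xm (- (m0 *+ K))) =
    pure (iota (monoid_algU 1 (SmK K')) * b) (xm (- (m0 *+ (K + K')))).
  rewrite (tensor_pure_act actB actT) /=; congr tensor_pure.
  by rewrite -xmD mulrnDr opprD addrCA subrr addr0.
have denD p q : den p -> den q -> den (p + q).
  move=> [K [b ->]] [K' [b' ->]].
  rewrite (raise b K K') (raise b' K' K) addnC -tensor_pureDl.
  by eexists; eexists.
have denN p : den p -> den (- p).
  by move=> [K [b ->]]; exists K, (- b); rewrite tensor_pureNl.
have den_all q : den q.
  elim/tensor_ind: q => [p q hp hq|b t]; first by apply/denD => //; exact: denN.
  elim/ga_ind: t => [|t1 t2 IH1 IH2|c m].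
  - by exists 0%N, 0; rewrite tensor_pure0l tensor_pure0r.
  - by rewrite tensor_pureDr; exact: denD.
  (* Here [<< c *g m >>] is split as [<< c *g m + m0 *+ K >>] times [xm (- (m0 *+ K))], whose first
     factor is a scalar from the monoid algebra. *)
  have [K SK] := Sden m; exists K, (iota (monoid_algU c SK) * b).
  rewrite (tensor_pure_act actB actT) /=; congr tensor_pure.
  by rewrite ga_mulE ga_mulUU mulr1 addrK.
have lift_inj : injective lift.
  have lift0 p : lift p = 0 -> p = 0.
    have [K [b ->]] := den_all p.
    rewrite liftp => /(congr1 ( *:%R (xm (m0 *+ K)))).
    rewrite scalerA xmV scaler0 scale1r => phib.
    by rewrite (phi_inj (etrans phib (esym (raddf0 phi)))) tensor_pure0l.
  have liftN p : lift (- p) = - lift p.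
    have lift00 : lift 0 = 0 by apply: (addrI (lift 0)); rewrite -liftD !addr0.
    by apply: (addrI (lift p)); rewrite -liftD !subrr.
  move=> p q pq; apply/eqP.
  by rewrite -subr_eq0 [p - q]lift0 // liftD liftN pq subrr.
have lift_surj X : exists q, lift q = X.
  rewrite [X]matrix_sum_delta; elim/big_ind: _ => [|_ _ [p <-] [q <-]|i _].
  - by exists (pure 0 0); rewrite liftp scale0r.
  - by exists (p + q); rewrite liftD.
  elim/big_ind: _ => [|_ _ [p <-] [q <-]|j _].
  - by exists (pure 0 0); rewrite liftp scale0r.
  - by exists (p + q); rewrite liftD.
  have [m [b bE]] := delta_in i j; exists (pure b (X i j * xm (- m))).
  rewrite liftp bE scalerA; congr (_ *: _).
  by rewrite -[LHS]mulrA [X in _ * X]mulrC xmV mulr1.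
have [g gK] := choice lift_surj.
by exists g => // q; apply: lift_inj; rewrite gK.
Qed.

End OrderCriterion.

(** * Integral functionals on rational polyhedral cones *)

Section ConePairing.
Variables (R : realType) (N : vectType int).

(** For additive [u] this is its real-linear extension to the real space of [N], in the coordinates
    given by [v2r]. *)
Definition real_pairing (u : N -> int) (x : 'rV[R]_(dim N)) : R :=
  \sum_j x 0 j * (u (r2v (delta_mx 0 j)))%:~R.

Lemma real_pairing_to_real (u : {additive N -> int}) v :
  real_pairing u (to_real R v) = (u v)%:~R.
Proof.
rewrite -{2}[v]v2rK [v2r v]row_sum_delta linear_sum raddf_sum rmorph_sum.
apply: eq_bigr => j _; rewrite mxE linearZ /=.
rewrite -[v2r v 0 j in RHS]intz scaler_int.
by rewrite raddfMz mulrzz rmorphM mulrC.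
Qed.

Lemma real_pairing_comb (u : {additive N -> int}) n (c : 'I_n -> R)
    (v : 'I_n -> N) :
  real_pairing u (\sum_i c i *: to_real R (v i)) = \sum_i c i * (u (v i))%:~R.
Proof.
under [RHS]eq_bigr do rewrite -real_pairing_to_real big_distrr /=.
rewrite exchange_big; apply: eq_bigr => j _ /=.
by rewrite summxE big_distrl; apply: eq_bigr => i _; rewrite mxE mulrA.
Qed.

Lemma to_real0 : to_real R (0 : N) = 0.
Proof. by apply/rowP=> j; rewrite !mxE linear0 mxE. Qed.

Lemma to_realN (v : N) : to_real R (- v) = - to_real R v.
Proof. by apply/rowP=> j; rewrite !mxE linearN mxE rmorphN. Qed.

Lemma to_real_eq0 (v : N) : to_real R v = 0 -> v = 0.
Proof.
move=> /rowP v0; apply: v2r_inj; rewrite linear0; apply/rowP=> j.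
by have /eqP := v0 j; rewrite !mxE intr_eq0 => /eqP.
Qed.

Lemma cone_generators (s : seq N) v :
  v \in s -> cone_generated_by s (to_real R v).
Proof.
rewrite -index_mem => ltvs; pose i0 := Ordinal ltvs.
exists (fun i => (i == i0)%:R); split=> [i|]; first exact: ler0n.
rewrite (bigD1 i0) //= eqxx scale1r nth_index -?index_mem // big1 ?addr0 //.
by move=> i /negPf->; rewrite scale0r.
Qed.

Lemma cone_ge0 (s : seq N) (u : {additive N -> int}) v :
  (forall w, w \in s -> 0 <= u w) -> cone_generated_by s (to_real R v) ->
  0 <= u v.
Proof.
move=> us [c [c0 vE]]; rewrite -(ler_int R) -real_pairing_to_real vE.
rewrite real_pairing_comb sumr_ge0 // => i _; apply: mulr_ge0 => //.
by rewrite ler0z us // mem_nth.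
Qed.

(** The extension of [u] is nonnegative on the cone, so it vanishes at [x] when both [x] and [- x]
    lie there. Each term of the sum giving its value is nonnegative, hence zero, which kills the
    coefficient of every nonzero generator. *)
Lemma strongly_convex_cone (s : seq N) (u : {additive N -> int}) :
  (forall w, w \in s -> w != 0 -> 0 < u w) ->
  strongly_convex (cone_generated_by (R := R) s).
Proof.
move=> us _ [c [c0 ->]] [c' [c'0 xE]].
have uge0 i : 0 <= u s`_i.
  have [->|nz] := eqVneq s`_i 0; first by rewrite raddf0.
  have [ltis|leis] := ltnP i (size s); first by rewrite ltW ?us ?mem_nth.
  by rewrite nth_default ?eqxx in nz.
apply: big1 => i _; have [->|nz] := eqVneq s`_i 0.
  by rewrite to_real0 scaler0.
suff /eqP : c i * (u s`_i)%:~R = 0.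
  rewrite mulf_eq0 intr_eq0 [u _ == 0]gt_eqF ?orbF ?us ?mem_nth //.
  by move=> /eqP->; rewrite scale0r.
have terms_ge0 (e : 'I_(size s) -> R) : (forall i, 0 <= e i) ->
    forall j, true -> 0 <= e j * (u s`_j)%:~R.
  by move=> e0 j _; rewrite mulr_ge0 ?ler0z.
have sum0 : \sum_j c j * (u s`_j)%:~R = 0.
  apply/eqP; rewrite eq_le sumr_ge0 ?andbT; last exact: terms_ge0.
  rewrite -oppr_ge0 -(real_pairing_comb u c).
  have -> (x : 'rV[R]_(dim N)) : - real_pairing u x = real_pairing u (- x).
    by rewrite -sumrN; apply: eq_bigr => j _; rewrite mxE mulNr.
  by rewrite xE real_pairing_comb sumr_ge0 //; exact: terms_ge0.
by apply: (psumr_eq0P (terms_ge0 c c0) sum0).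
Qed.

End ConePairing.

(** * Positivity on the cone of noncommutative toric data *)

Section ToricDataTheory.
Variables (R : realType) (Q0 : finType) (N : vectType int).
Variables (d : {additive {ffun Q0 -> int} -> N}) (Np : set N).
Local Notation M := 'Hom(N, int^o).
Hypothesis data : nc_toric_data d Np R.

Let at_additive (u : M) : {additive N -> int} :=
  [the {additive N -> int^o} of fun_of_lfun u].

(** Both defining conditions of the data enter here: non-emptiness completes an element of M_ij^+ to
    one of M_o^+, and duality turns vanishing on M^gen into membership of [- v] in [Np]. *)
Lemma Np_separated v : Np v -> v != 0 ->
  exists2 m : Mo d, Mplus Np (\val m) & 0 < \val m v.
Proof.
move=> Npv; apply: contra_neqP => nosep.
have Mo0 (m : Mo d) : Mplus Np (\val m) -> \val m v = 0.
  move=> mP; apply/eqP; rewrite eq_le (mP v Npv) andbT leNgt; apply/negP=> mv.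
  by apply: nosep; exists m.
have Mij0 i j u : Mijplus d Np i j u -> u v = 0.
  move=> uij; have [u' u'ji] := nctd_nonempty data j i.
  have [uu' uu'P] := MijplusD uij u'ji.
  have uu'ker : u + u' \in ker_pred (bdry d).
    by rewrite unfold_in; apply/eqP; exact: etrans uu' (subrr _).
  have := Mo0 (KerLattice uu'ker) uu'P; rewrite /= add_lfunE => /eqP.
  have [_ /(_ v Npv) u0] := uij; have [_ /(_ v Npv) u'0] := u'ji.
  by rewrite paddr_eq0 // => /andP[/eqP].
have Mgen_v u : Mgen d Np u -> u v = 0.
  elim=> [|i j {}u w /Mij0 uv _ wv]; first by rewrite zero_lfunE.
  by rewrite add_lfunE uv wv addr0.
have NpNv : Np (- v).
  rewrite (nctd_dual data) => u /Mgen_v uv.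
  by have -> : u (- v) = - (0 : int^o) by rewrite linearN; congr (- _).
have [sigma [_ sconv NpE]] := nctd_cone data.
move: Npv NpNv; rewrite NpE /lattice_points /= to_realN => sv /(sconv _ sv).
exact: to_real_eq0.
Qed.

Variable s : seq N.
Hypothesis NpE : Np = lattice_points (cone_generated_by (R := R) s).

Lemma gens_Np v : v \in s -> Np v.
Proof. by rewrite NpE => vs; exact: cone_generators. Qed.

(** Membership in M^+ becomes finitely many integer inequalities, the form needed for Dickson's
    lemma and for the choice of large multiples. *)
Lemma MplusP u : Mplus Np u <-> forall v, v \in s -> 0 <= u v.
Proof.
split=> [uP v vs|us v]; first exact/uP/gens_Np.
by rewrite NpE; exact: (cone_ge0 (u := at_additive u)).
Qed.

(** Add up separating elements, one for each nonzero generator: every summand is nonnegative on all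
    of [s], so positivity obtained at one generator survives. *)
Lemma Mo_interior : exists2 m0 : Mo d, Mplus Np (\val m0) &
  forall v, v \in s -> v != 0 -> 0 < \val m0 v.
Proof.
have := gens_Np; elim: s => [|v s' IH] sNp; first by exists 0; [exact: Mplus0|].
have [|m0 m0P m0s] := IH; first by move=> w ws; apply: sNp; rewrite inE ws orbT.
have Npv : Np v by apply: sNp; rewrite inE eqxx.
have [v0|vn0] := eqVneq v 0.
  by exists m0 => // w; rewrite inE => /orP[/eqP->|/m0s//]; rewrite v0 eqxx.
have [m mP mv] := Np_separated Npv vn0.
exists (m + m0); first exact: MplusD.
move=> w ws wn0; rewrite add_lfunE.
move: ws; rewrite inE => /orP[/eqP->|ws'].
  by rewrite ltr_wpDr // m0P.
rewrite ltr_wpDl ?m0s //; apply: mP; apply: sNp.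
by rewrite inE ws' orbT.
Qed.

Lemma Mplus_absorb (m0 u : M) : (forall v, v \in s -> v != 0 -> 0 < m0 v) ->
  exists K, Mplus Np (u + m0 *+ K).
Proof.
move=> m0s; exists (\sum_(v <- s) absz (u v))%N; apply/MplusP=> v vs.
have -> : (u + m0 *+ (\sum_(v <- s) absz (u v))%N) v =
          u v + m0 v *+ (\sum_(v <- s) absz (u v))%N :> int.
  rewrite add_lfunE; elim: (bigop _ _ _) => [|K IHK].
    by rewrite !mulr0n zero_lfunE.
  by rewrite !mulrS add_lfunE addrCA IHK addrCA.
have [->|vn0] := eqVneq v 0; first by rewrite !linear0 mul0rn.
set K := (\sum_(v <- s) _)%N; have uvK : (absz (u v) <= K)%N.
  by rewrite /K (big_rem v) //= leq_addr.
have K_le : (K%:Z <= (m0 v : int) *+ K).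
  by rewrite -natz lerMn2r; apply/orP; right; exact: m0s.
apply: le_trans (_ : 0 <= (u v : int) + K%:Z) _; last by rewrite lerD2l.
rewrite -lerBlDr sub0r lerNl; apply: le_trans (ler_norm _) _.
by rewrite normrN -abszE lez_nat.
Qed.

End ToricDataTheory.

(** * The toric variety of M_o^+ and the embedding of B *)

Section NCToricOrder.
Variables (R : realType) (Q0 : finType) (N : vectType int).
Variables (d : {additive {ffun Q0 -> int} -> N}) (Np : set N).
Local Notation M := 'Hom(N, int^o).
Hypothesis data : nc_toric_data d Np R.
Variable s : seq N.
Hypothesis NpE : Np = lattice_points (cone_generated_by (R := R) s).

(** The values of [\val m + w] on [s] are nonnegative for the exponents considered, so [absz] does
    not alter them. Domination by the values for [f] then says that [m - f] is nonnegative on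
    [s]. *)
Lemma Moplus_module_fg (w : M) : exists F : seq (Mo d),
  (forall f, f \in F -> Mplus Np (\val f + w)) /\
  forall m : Mo d, Mplus Np (\val m + w) ->
    exists2 f, f \in F & (Moplus d Np : set _) (m - f).
Proof.
pose gs := [seq (fun m : Mo d => absz ((\val m + w) v)) | v <- s].
have [F [FP Fdom]] := dickson gs [set m | Mplus Np (\val m + w)].
exists F; split=> // m mP; have [f fF /allP fm] := Fdom m mP; exists f => //.
apply/(MplusP NpE) => v vs.
have /= := fm _ (map_f _ vs).
have Npv := gens_Np NpE vs.
rewrite -lez_nat !gez0_abs; [|exact: mP Npv|exact: FP fF _ Npv].
by rewrite -subr_ge0 !add_lfunE opp_lfunE opprD addrACA subrr addr0.
Qed.

Section Restriction.
Variable v : N.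

Definition Mo_eval (m : Mo d) : int^o := \val m v.

Lemma Mo_eval_linear : linear Mo_eval.
Proof. by move=> a m m'; rewrite /Mo_eval /= add_lfunE scale_lfunE. Qed.
HB.instance Definition _ :=
  GRing.isLinear.Build int (Mo d) int^o *:%R Mo_eval Mo_eval_linear.

End Restriction.

(** The transpose of the inclusion of M_o in M, applied to [v] as a functional on M. *)
Definition dual_restriction (v : N) : 'Hom(Mo d, int^o) := linfun (Mo_eval v).

Lemma dual_restrictionE v m : dual_restriction v m = \val m v.
Proof. by rewrite lfunE. Qed.

(** An element of [L] as a functional on the dual lattice, so that the cone lemmas apply with that
    dual in place of [N]. *)
Definition eval_at (L : vectType int) (m : L) (f : 'Hom(L, int^o)) : int := f m.

Lemma eval_at_nmod (L : vectType int) (m : L) : nmod_morphism (eval_at m).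
Proof. by split=> [|f g]; rewrite /eval_at ?zero_lfunE ?add_lfunE. Qed.
HB.instance Definition _ (L : vectType int) (m : L) :=
  GRing.isNmodMorphism.Build 'Hom(L, int^o) int (eval_at m) (eval_at_nmod m).

(** The cone is spanned by the restrictions of the generators [s] to M_o. It is strongly convex
    since evaluation at the interior point [m0] is positive on the nonzero ones. *)
Lemma Moplus_affine_toric : affine_toric R (Moplus d Np).
Proof.
have [m0 _ m0s] := Mo_interior data NpE.
pose so := map dual_restriction s.
have so_pos w : w \in so -> w != 0 -> 0 < eval_at m0 w.
  move=> /mapP[v vs ->]; rewrite /eval_at dual_restrictionE => nz.
  apply: m0s => //; apply: contra_neq nz => ->; apply/lfunP => m.
  by rewrite dual_restrictionE linear0 zero_lfunE.
exists (lattice_points (cone_generated_by (R := R) so)).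
  exists (cone_generated_by so); split=> //; first by exists so.
  exact: (strongly_convex_cone (u := eval_at m0)).
apply/seteqP; split=> m.
  move=> mP w; apply: (cone_ge0 (u := eval_at m)) => _ /mapP[v vs ->].
  by rewrite /= /eval_at dual_restrictionE mP //; exact: (gens_Np NpE).
move=> mP; apply/(MplusP NpE) => v vs.
by rewrite -dual_restrictionE; apply/mP/cone_generators/map_f.
Qed.

(** The functions [chi i] add up to the constant 1, which [d] kills. *)
Lemma bdry_sum0 u : \sum_i bdry d u i = 0.
Proof.
have d1 : d [ffun=> 1] = 0 by apply/(nctd_ker data); exists 1.
have sum_chi : \sum_i chi i = [ffun=> 1] :> {ffun Q0 -> int}.
  apply/ffunP=> j; rewrite sum_ffunE ffunE (bigD1 j) //= ffunE eqxx.
  by rewrite big1 ?addr0 // => i ij; rewrite ffunE eq_sym (negPf ij).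
under eq_bigr do rewrite ffunE.
transitivity (u (\sum_i d (chi i)) : int); first by rewrite linear_sum.
by rewrite -raddf_sum sum_chi d1 linear0.
Qed.

(** The offsets are [w i j = u j - u i]; they record the translation by which M_ij is identified
    with M_o. *)
Lemma Mo_projection : exists (pr : {additive M -> Mo d}) (w : Q0 -> Q0 -> M),
  [/\ cancel \val pr,
      forall i j u, Mij d i j u -> u = \val (pr u) + w i j
    & forall i j, Mij d i j (w i j) /\ pr (w i j) = 0].
Proof.
have [u [c uE]] : exists (u : Q0 -> M) c, forall i, bdry d (u i) = chi i - c.
  (* A base vertex [i0] gives [c = chi i0]; for empty [Q0] the condition is vacuous. *)
  have [i0 _|noQ0] := pickP (fun _ : Q0 => true); last first.
    by exists (fun=> 0), 0 => i; have := noQ0 i.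
  have [u uE] := choice (fun i => nctd_nonempty data i0 i).
  by exists u, (chi i0) => i; have [] := uE i.
pose pr0 m : M := m - \sum_i u i *~ bdry d m i.
have chiE (f : {ffun Q0 -> int}) : \sum_i chi i *~ f i = f.
  apply/ffunP=> j; rewrite sum_ffunE (bigD1 j) //= ffunMzE ffunE eqxx mulr1n.
  rewrite big1 ?addr0 ?intz // => i ij.
  by rewrite ffunMzE ffunE eq_sym (negPf ij) mul0rz.
(* The [chi i] parts of [bdry d (u i)] rebuild [bdry d m], while [c] gets the total coefficient
   [\sum_i bdry d m i], which is 0. *)
have pr0_ker m : pr0 m \in ker_pred (bdry d).
  rewrite unfold_in; apply/eqP; rewrite /pr0 raddfB raddf_sum /=.
  under eq_bigr do rewrite raddfMz /= uE mulrzBl.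
  by rewrite sumrB chiE -mulrz_sumr bdry_sum0 mulr0z subr0 subrr.
pose pr m : Mo d := KerLattice (pr0_ker m).
have pr_nmod : nmod_morphism pr.
  split=> [|m m']; apply: val_inj => /=.
    by rewrite /pr0 raddf0 big1 ?subr0 // => i _; rewrite ffunE mulr0z.
  rewrite /pr0 raddfD /= addrACA -opprD -big_split; congr (_ - _).
  by apply: eq_bigr => i _; rewrite ffunE mulrzDr.
have u_chi j : \sum_i u i *~ chi j i = u j.
  rewrite (bigD1 j) //= ffunE eqxx big1 ?addr0 ?mulr1z // => i ij.
  by rewrite ffunE (negPf ij) mulr0z.
have prE i j m : Mij d i j m -> pr0 m = m - (u j - u i).
  move=> mij; rewrite /pr0 mij; congr (_ - _).
  under eq_bigr do rewrite [(chi j - chi i) _]ffunE [(- chi i) _]ffunE mulrzBr.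
  by rewrite sumrB !u_chi.
have wij i j : Mij d i j (u j - u i).
  by rewrite /Mij /= raddfB /= !uE opprB addrA subrK.
pose pr_add : {additive M -> Mo d} :=
  HB.pack pr (GRing.isNmodMorphism.Build _ _ pr pr_nmod).
exists pr_add, (fun i j => u j - u i); split=> [m|i j m /prE /= prm|i j].
- apply: val_inj => /=; rewrite /pr0 (eqP (valP m)).
  by rewrite big1 ?subr0 // => i _; rewrite ffunE mulr0z.
- by rewrite prm subrK.
- by split=> //; apply: val_inj; rewrite /= (prE i j) // subrr.
Qed.

Section Embedding.
Variable k : comNzRingType.
Variables (pr : {additive M -> Mo d}) (w : Q0 -> Q0 -> M).
Hypothesis prK : cancel \val pr.
Hypothesis prE : forall i j u, Mij d i j u -> u = \val (pr u) + w i j.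
Hypothesis w_in : forall i j, Mij d i j (w i j).
Hypothesis pr_w : forall i j, pr (w i j) = 0.
Local Notation T := (grpalg k (Mo d)).
Local Notation B := (nc_toric_alg k d Np).

Definition toric_emb : {rmorphism B -> 'M[T]_#|Q0|} :=
  map_mx (ga_map (k := k) pr) \o \val.

Lemma toric_embE b i j : toric_emb b i j = ga_map pr (\val b i j).
Proof. by rewrite mxE. Qed.

Lemma toric_emb_diag r : toric_emb (diag_emb r) = (\val r)%:M.
Proof.
by apply/matrixP=> i j; rewrite toric_embE !mxE raddfMn /= ga_mapK.
Qed.

Local Notation wn i j := (w (enum_val i) (enum_val j)).
Local Notation xw i j := (<< 1 *g wn i j >> : grpalg k M).

(** Multiplication by [xw i j] reverses the translation that [pr] performs on M_ij, so each entry
    can be recovered from its image. *)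
Lemma toric_emb_inv (b : B) i j :
  \val b i j = xw i j * ga_map (\val : {additive Mo d -> M}) (toric_emb b i j).
Proof.
have := valP b; rewrite unfold_in => /asboolP/(_ i j); rewrite toric_embE.
elim/supported_ind => [|f g IHf IHg|c m [mij _]].
- by rewrite !raddf0 mulr0.
- rewrite !ga_mapD mulrDr; congr (_ + _); [exact: IHf|exact: IHg].
by rewrite !ga_mapU ga_mulE ga_mulUU mul1r addrC -prE.
Qed.

Lemma toric_emb_inj : injective toric_emb.
Proof.
by move=> b b' bb'; apply/val_inj/matrixP=> i j; rewrite !toric_emb_inv bb'.
Qed.

(** A preimage is found by translating each entry back by [xw i j]. It projects to [X] because [pr]
    kills [w] and retracts onto M_o. *)
Lemma toric_embP (X : 'M[T]_#|Q0|) : (exists b, toric_emb b = X) <->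
  forall i j, supported [set m | Mplus Np (\val m + wn i j)] (X i j).
Proof.
split=> [[b <-] i j|XP].
  rewrite toric_embE; have := valP b; rewrite unfold_in => /asboolP/(_ i j).
  by apply: supported_map => m [/prE mE mP] /=; rewrite -mE.
pose Y : 'M[grpalg k M]_#|Q0| :=
  \matrix_(i, j) (xw i j * ga_map (\val : {additive Mo d -> M}) (X i j)).
have YP : Y \in nc_toric_pred (k := k) d Np.
  rewrite unfold_in; apply/asboolP => i j; rewrite mxE.
  elim/supported_ind: (XP i j) => [|f g IHf IHg|c m mP].
  - by rewrite raddf0 mulr0; exact: supported0.
  - by rewrite ga_mapD mulrDr; exact: supportedD.
  rewrite ga_mapU ga_mulE ga_mulUU addrC; apply: supportedU; split=> //.
  have /eqP m0 := valP m.
  by rewrite /Mij /= raddfD /= m0 add0r; exact: w_in.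
exists (NCToricAlg YP); apply/matrixP=> i j.
rewrite toric_embE /= mxE rmorphM /=.
by rewrite ga_mapU pr_w ga_mapK // -ga_1E mul1r.
Qed.

End Embedding.
End NCToricOrder.

Theorem lemma5p10 (R : realType) (Q0 : finType) (N : vectType int)
    (d : {additive {ffun Q0 -> int} -> N}) (Np : set N)
    (data : nc_toric_data d Np R) :
  toric_order (S := Moplus d Np) (B := nc_toric_alg R[i] d Np)
    (@diag_emb R[i] Q0 N d Np).
Proof.
have [sigma [[s sigmaE] _ NpE]] := nctd_cone data; rewrite {}sigmaE in NpE.
have [m0 m0P m0s] := Mo_interior data NpE.
have [pr [w [prK prE w_in_pr]]] := Mo_projection data.
have w_in i j := (w_in_pr i j).1; have pr_w i j := (w_in_pr i j).2.
pose phi : {rmorphism nc_toric_alg R[i] d Np -> 'M[grpalg R[i] (Mo d)]_#|Q0|} :=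
  toric_emb Np R[i] pr.
have phiP := toric_embP Np (k := R[i]) prK prE w_in pr_w.
rewrite -/phi in phiP.
have phi_inj : injective phi := toric_emb_inj prE.
have phi_diag r : phi (diag_emb r) = (\val r)%:M by exact: toric_emb_diag.
split; first exact: (Moplus_affine_toric data NpE).
  by move=> r b; apply: val_inj; exact/esym/scalar_mxC.
exists (pullback_grading phi), #|Q0|, phi; split.
- apply: (pullback_is_grading phi_inj phi_diag) => b m.
  (* [phiP] describes the image by supports alone, a condition inherited by homogeneous
     components. *)
  have /phiP bP : exists b', phi b' = phi b by exists b.
  have [|b' b'E] := (phiP (\matrix_(i, j) << (phi b i j)@_m *g m >>)).2.
    move=> i j; rewrite mxE; have [->|nz] := eqVneq (phi b i j)@_m 0.
      by rewrite monalgU0; exact: supported0.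
    by apply: supportedU; apply: bP; exact: nz.
  by exists b' => i j; rewrite b'E mxE.
- by [].
- by [].
(* The generators are the matrices with single entry [<< 1 *g f >>] at [ij], for [f] in the finite
   set [F ij] of module generators. *)
- have [F FE] := choice (fun ij : 'I_#|Q0| * 'I_#|Q0| =>
    Moplus_module_fg d NpE (w (enum_val ij.1) (enum_val ij.2))).
  pose gen (ij : 'I_#|Q0| * 'I_#|Q0|) (f : Mo d) :
      'M[grpalg R[i] (Mo d)]_#|Q0| :=
    (<< 1 *g f >> : grpalg R[i] (Mo d)) *: delta_mx ij.1 ij.2.
  exists (flatten [seq [seq gen ij f | f <- F ij] | ij <- enum predT]) => X.
  set gens := flatten _; rewrite phiP; split=> [XP|[c ->] i j].
    change (span_over (Moplus d Np) gens X); rewrite [X]matrix_sum_delta.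
    elim/big_ind: _ => [||i _]; [exact: span_over0|exact: span_overD|].
    elim/big_ind: _ => [||j _]; [exact: span_over0|exact: span_overD|].
    elim/supported_ind: (XP i j) => [|t t' IHt IHt'|c m mP].
    - by rewrite scale0r; exact: span_over0.
    - by rewrite scalerDl; exact: span_overD.
    have [FP /(_ m mP)[f fF Smf]] := FE (i, j).
    have -> : << c *g m >> =
        \val (monoid_algU c Smf) * << 1 *g f >> :> grpalg R[i] (Mo d).
      by rewrite ga_mulE /= ga_mulUU mulr1 subrK.
    have gens_f : gen (i, j) f \in gens.
      by apply/flatten_mapP; exists (i, j); rewrite ?mem_enum //; exact: map_f.
    have := span_over_gen (monoid_algU c Smf) gens_f.
    by rewrite /gen scalerA.
  (* Conversely, the exponents of each generator satisfy the support condition, which is stable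
     under adding elements of M_o^+. *)
  rewrite summxE; apply: supported_sum => l; rewrite mxE.
  have /flatten_mapP[ij _ /mapP[f fF ->]] := mem_nth 0 (ltn_ord l).
  rewrite !mxE; case: andP => [[/eqP-> /eqP->]|_]; last first.
    by rewrite !mulr0; exact: supported0.
  rewrite mulr1; have := valP (c l); rewrite unfold_in => /asboolP cS.
  have fS : supported [set f] (<< 1 *g f >> : grpalg R[i] (Mo d)).
    exact: supportedU.
  apply: (supportedM _ cS fS) => m _ mP -> /=.
  by rewrite -addrA; apply: MplusD mP _; have [+ _] := FE ij; apply.
- apply: (tensor_lift_bij phi_inj phi_diag (m0 := m0)) => [//|m|i j].
    have [K KP] := Mplus_absorb NpE (\val m) m0s.
    exists K; change (Mplus Np (\val (m + m0 *+ K))).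
    by rewrite raddfD raddfMn.
  (* Any [v] in M_ij^+ gives an element of [B] with single entry x^v, whose image is x^(pr v) times
     the matrix unit. *)
  have [v vij] := nctd_nonempty data (enum_val i) (enum_val j).
  exists (pr v); apply/phiP => i' j'; rewrite !mxE.
  case: andP => [[/eqP-> /eqP->]|_]; last by rewrite mulr0; exact: supported0.
  rewrite mulr1; apply: supportedU => /=.
  by have [vM vP] := vij; rewrite -(prE _ _ _ vM).
Qed.
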